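(* Suppose that $\kappa$ is a measurable cardinal and $X$ is a locally $<\kappa$ Hausdorff space of size $\kappa$ such that every point in $X$ has a point-base (local base) of size $<\kappa$, and suppose that $X$ is $\sigma$-$D$ for some regular uncountable cardinal $\sigma<\kappa$. Then for every $\theta<\kappa$ there is $Y\subseteq X$ which is an open $\sigma$-$D$ subspace of $X$ and satisfies \[ \theta<|Y|<\kappa. \]
   Context: An open neighbourhood assignment (ONA) in a topological space $(X,\tau)$ is a function $U:X\to\tau$ such that $x\in U(x)$ for all $x\in X$. For $D\subseteq X$ write $\bigcup U``D=\bigcup\{U(x):x\in D\}$. An ONA $V$ is finer than $U$ iff $V(x)\subseteq U(x)$ for all $x\in X$. $X$ is locally $<\kappa$ iff there is an ONA $U$ of $X$ with $|U(x)|<\kappa$ for all $x\in X$. A subset $D\subseteq X$ is $U$-sticky iff $D$ is closed discrete in $X$ and for all $x\in X$, $U(x)\cap D\ne\emptyset$ implies $x\in\bigcup U``D$. For a regular cardinal $\sigma\ge\aleph_1$, $\mathbb{P}^\sigma_U(X)$ is the set of all $U$-sticky $D\subseteq X$ with $|D|<\sigma$, ordered by: $D\le D'$ iff $D\subseteq D'$ and $(D'\setminus D)\cap\bigcup U``D=\emptyset$. $X$ is $\sigma$-$D$ with respect to an ONA $U$ of $X$ iff for every $D\in\mathbb{P}^\sigma_U(X)$ and every $x\in X$ there is $D'\ge D$ in $\mathbb{P}^\sigma_U(X)$ with $x\in\bigcup U``D'$. $X$ is $\sigma$-$D$ iff for every ONA $U$ of $X$ there is a finer ONA $V$ of $X$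 such that $X$ is $\sigma$-$D$ with respect to $V$. *)

(* Defs.v *)
(* A cardinal is represented by a type [K], standing for the cardinality of
   [[set: K]]; cardinals are only ever compared through [#<=], [#=], [#<]. *)
From HB Require Import structures.
From mathcomp Require Import all_boot all_order.
From mathcomp Require Import mathcomp_extra boolp classical_sets functions.
From mathcomp Require Import cardinality wochoice filter topology.

Set Implicit Arguments.
Unset Strict Implicit.
Unset Printing Implicit Defensive.

Local Open Scope classical_set_scope.
Local Open Scope card_scope.

Definition card_lt T U (A : set T) (B : set U) : Prop :=
  A #<= B /\ ~ (B #<= A).
Notation "A '#<' B" := (card_lt A B) (at level 79) : card_scope.

(* [R] is a well-order of [S] whose type is the initial ordinal |S|: every
   proper initial segment is smaller than [S]. *)
Definition initial_well_order S (R : rel S) : Prop :=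
  well_order R /\ forall x, [set y | R y x /\ y <> x] #< [set: S].

(* cf(|S|) = |S|. Initial well-orders of [S] exist and are all isomorphic, so
   it does not matter which one is used. *)
Definition regular_cardinal S : Prop :=
  infinite_set [set: S] /\
  exists2 R : rel S, initial_well_order R &
    forall A : set S, (forall x, exists2 a, A a & R x a) -> A #= [set: S].

Definition complete_filter K (F : set_system K) : Prop :=
  forall G : set_system K,
    G #< [set: K] -> G `<=` F -> F (\bigcap_(A in G) A).

Definition measurable_cardinal K : Prop :=
  ~ countable [set: K] /\
  exists F : set_system K,
    [/\ UltraFilter F, forall x, F <> principal_filter x & complete_filter F].

Section Spaces.
Variable X : topologicalType.
Implicit Types (U V : X -> set X) (D : set X) (x : X).

Definition ona U : Prop := forall x, open_nbhs x (U x).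

Definition finer V U : Prop := forall x, V x `<=` U x.

Definition locally_lt K : Prop :=
  exists2 U, ona U & forall x, U x #< [set: K].

Definition point_base x (B : set (set X)) : Prop :=
  B `<=` open_nbhs x /\ forall N, nbhs x N -> exists2 A, B A & A `<=` N.

Definition closed_discrete D : Prop := closed D /\ D `<=` isolated D.

Definition sticky U D : Prop :=
  closed_discrete D /\
  forall x, U x `&` D !=set0 -> (\bigcup_(y in D) U y) x.

Definition sticky_poset S U : set (set X) :=
  [set D | sticky U D /\ D #< [set: S]].

Definition sticky_le U D D' : Prop :=
  D `<=` D' /\ (D' `\` D) `&` (\bigcup_(y in D) U y) = set0.

Definition sigma_D_wrt S U : Prop :=
  forall D x, sticky_poset S U D ->
    exists D', [/\ sticky_poset S U D', sticky_le U D D'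
                 & (\bigcup_(y in D') U y) x].

Definition sigma_D S : Prop :=
  forall U, ona U -> exists V, [/\ ona V, finer V U & sigma_D_wrt S V].

End Spaces.

Definition subspace_of (X : topologicalType) (Y : set X) : topologicalType :=
  initial_topology (set_val : Y -> X).

(* Main.v *)
(* Let [j : V -> M] be the ultrapower embedding with critical point [kappa], and
   let [X] have underlying set [kappa]. As points have small neighbourhoods and
   small bases, [X] is an open subspace of [j(X)], and it is still sigma-D in
   [M]; so [M] thinks that [j(X)] has an open sigma-D subspace of size between
   [theta] and [j(kappa)], and elementarity gives one in [X].
   In ultrafilter terms, [X] as a subset of [j(X)] is represented by a family
   [Y k] of small initial segments of [X] that is normal modulo the ultrafilter,
   and almost every [Y k] is as desired. *)
Require Import Defs.
From mathcomp Require Import all_boot all_order.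
From mathcomp Require Import mathcomp_extra boolp classical_sets functions.
From mathcomp Require Import cardinality wochoice filter topology.

Local Open Scope classical_set_scope.
Local Open Scope card_scope.

(** * Cardinal comparison and initial well-orders *)

(** A relation needs no default value and can be formed as a limit along an ultrafilter, as in
    [ultraproduct_card_le]; choice recovers an injection. *)
Lemma card_le_relP {T U} (A : set T) (B : set U) :
  A #<= B <-> exists r : T -> U -> Prop,
    (forall x, A x -> exists2 y, B y & r x y) /\
    (forall x x' y, A x -> A x' -> r x y -> r x' y -> x = x').
Proof.
split=> [/card_leP[f]|[r [rtot rinj]]].
  exists (fun x y => exists a : A, set_val a = x /\ set_val (f a) = y); split.
    move=> x Ax; exists (set_val (f (SigSub (mem_set Ax)))).
      exact: set_valP.
    by exists (SigSub (mem_set Ax)).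
  move=> x x' y _ _ [a [<- <-]] [a' [<- /val_inj fE]].
  by rewrite (inj (mem_set I) (mem_set I) (esym fE)).
have /choice[f fP] : forall a : A, exists b : B, r (set_val a) (set_val b).
  move=> a; have [y By rxy] := rtot _ (set_valP a).
  by exists (SigSub (mem_set By)).
apply/card_leP/injfunPex; exists f => // a a' _ _ fE; apply/val_inj.
apply: (rinj _ _ (set_val (f a)) (set_valP a) (set_valP a') (fP a)).
by rewrite fE; exact: fP.
Qed.

Lemma card_le_inj {T U} {A : set T} {B : set U} (f : T -> U) :
  (forall x, A x -> B (f x)) ->
  (forall x x', A x -> A x' -> f x = f x' -> x = x') -> A #<= B.
Proof.
move=> fAB finj; apply/card_le_relP; exists (fun x y => f x = y); split.
  by move=> x Ax; exists (f x); [exact: fAB|].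
by move=> x x' y Ax Ax' <- /esym; exact: finj.
Qed.

Lemma card_leT_fun {T U} {B : set U} : [set: T] #<= B ->
  exists2 f : T -> U, injective f & forall x, B (f x).
Proof.
move=> /card_le_relP[r [rtot rinj]].
have /choice[f fP] : forall x, exists y, B y /\ r x y.
  by move=> x; have [y By rxy] := rtot x I; exists y.
exists f => [x x' fE|x]; last by have [] := fP x.
apply: (rinj _ _ (f x)) => //; first by have [] := fP x.
by rewrite fE; have [] := fP x'.
Qed.

Lemma card_le_lt_trans {T U V} {A : set T} (B : set U) {C : set V} :
  A #<= B -> B #< C -> A #< C.
Proof.
move=> AB [BC nCB]; split; first exact: card_le_trans AB BC.
by move=> CA; apply: nCB; exact: card_le_trans CA AB.
Qed.

Lemma card_lt_le_trans {T U V} {A : set T} (B : set U) {C : set V} :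
  A #< B -> B #<= C -> A #< C.
Proof.
move=> [AB nBA] BC; split; first exact: card_le_trans AB BC.
by move=> CA; apply: nBA; exact: card_le_trans BC CA.
Qed.

(** Lets [X] play the ordinal of its cardinality: small initial segments will serve as the sets
    [Y k], and well-foundedness will exclude descending sequences. *)
Lemma small_wf_order (X : choiceType) : exists lt : X -> X -> Prop,
  [/\ well_founded lt, forall x y, [\/ lt x y, x = y | lt y x] &
      forall x, [set y | lt y x] #< [set: X]].
Proof.
have [R Rwo] := well_ordering_principle X.
have Rxx x : R x x.
  have [|z [[/= /eqP-> zmin] _]] := Rwo (pred1 x); first by exists x; rewrite inE.
  by apply: zmin; rewrite inE.
pose lt0 x y := ~~ R y x.
have min0 (A : set X) : A !=set0 -> exists2 z, A z & forall x, A x -> ~ lt0 x z.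
  move=> [a Aa]; have [|z [[Az zmin] _]] := Rwo [pred x | `[< A x >]].
    by exists a; apply/asboolP.
  exists z; first exact/asboolP.
  by move=> x Ax; apply/negP; rewrite negbK; apply: zmin; apply/asboolP.
have wf0 : well_founded lt0.
  move=> x; apply: contrapT => nx.
  have [z nz zmin] : exists2 z, ~ Acc lt0 z & forall y, ~ Acc lt0 y -> ~ lt0 y z.
    by apply: (min0 [set y | ~ Acc lt0 y]); exists x.
  by apply: nz; constructor => y yz; apply: contrapT => /zmin /(_ yz).
have tri0 x y : [\/ lt0 x y, x = y | lt0 y x].
  have [xy|] := boolP (R x y); last by constructor 3.
  have [yx|] := boolP (R y x); last by constructor 1.
  constructor 2.
  (* Both [x] and [y] are least in the pair, and the least element is unique. *)
  have [|z [_ zuniq]] := Rwo (pred2 x y); first by exists x; rewrite inE eqxx.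
  rewrite -(zuniq x) ?(zuniq y) //; split; rewrite ?inE ?eqxx ?orbT //.
    by move=> w; rewrite inE => /orP[] /eqP ->.
  by move=> w; rewrite inE => /orP[] /eqP ->.
have [small|] := pselect (forall x, [set y | lt0 y x] #< [set: X]).
  by exists lt0.
move=> /existsNP/min0[x0 big0 min].
(* otherwise pull the order back along an injection of [X] into the shortest
   initial segment that is not smaller than [X] *)
have [g ginj gx0] : exists2 g : X -> X, injective g & forall x, lt0 (g x) x0.
  apply: (@card_leT_fun _ _ [set y | lt0 y x0]); apply: contrapT => n.
  apply: big0; split => //.
  exact: card_leT.
exists (fun x y => lt0 (g x) (g y)); split.
- suff acc z : forall x, g x = z -> Acc (fun x y => lt0 (g x) (g y)) x.
    by move=> x; exact: acc.
  elim: z / (wf0 z) => z _ IH x gx; constructor => y; rewrite gx => yz.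
  exact: IH yz _ erefl.
- move=> x y; have [|/ginj|] := tri0 (g x) (g y).
  + by constructor 1.
  + by constructor 2.
  + by constructor 3.
- move=> x; apply: (card_le_lt_trans [set y | lt0 y (g x)]).
    by apply: (card_le_inj g) => // y y' _ _; exact: ginj.
  by apply: contrapT => /min; apply; exact: gx0.
Qed.

(** * Completeness of ultrafilters *)

Section CompleteUltrafilter.
Context {K : Type} {F : set_system K}.
Hypotheses (UF : UltraFilter F) (cF : complete_filter F).

Lemma ultra_not (A : set K) : ~ F A -> F (~` A).
Proof. by move=> nFA; have [] := in_ultra_setVsetC A UF. Qed.

Lemma complete_small {T} (A : set T) (P : T -> set K) : A #< [set: K] ->
  (forall a, A a -> F (P a)) -> F [set k | forall a, A a -> P a k].
Proof.
move=> smallA FP; have := cF (P @` A).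
rewrite bigcap_image; apply; last by move=> _ [a /FP ? <-].
exact: card_le_lt_trans _ (card_image_le _ _) smallA.
Qed.

(** If every single [a] failed almost everywhere, completeness would make all of them fail at
    once. *)
Lemma complete_choose {T} (A : set T) (P : K -> T -> Prop) : A #< [set: K] ->
  F [set k | exists2 a, A a & P k a] -> exists2 a, A a & F [set k | P k a].
Proof.
move=> smallA FP; apply: contrapT => nP.
have FnP : F [set k | forall a, A a -> ~ P k a].
  apply: (complete_small _ (fun a => [set k | ~ P k a])) => // a Aa.
  by apply: ultra_not => FPa; apply: nP; exists a.
by have [k [[a Aa Pka] /(_ a Aa)]] := filter_ex (filterI FP FnP).
Qed.

(** Fix injective relations [r k] from [Z k] to [B]. As [B] is small, each [x] gets one [y] with
    [r k x y] for almost all [k]; injectivity is read off at a single [k]. *)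
Lemma ultraproduct_card_le {T U} (A : set T) (Z : K -> set T) (B : set U) :
  B #< [set: K] -> (forall x, A x -> F [set k | Z k x]) ->
  F [set k | Z k #<= B] -> A #<= B.
Proof.
move=> smallB AZ ZB.
have /choice[r rP] : forall k, exists r : T -> U -> Prop, Z k #<= B ->
    (forall x, Z k x -> exists2 y, B y & r x y) /\
    (forall x x' y, Z k x -> Z k x' -> r x y -> r x' y -> x = x').
  move=> k; have [/card_le_relP[r rP]|nZB] := pselect (Z k #<= B).
    by exists r.
  by exists (fun _ _ => False).
apply/card_le_relP; exists (fun x y => F [set k | r k x y]); split.
  move=> x Ax; apply: complete_choose => //.
  by apply: filterS (filterI ZB (AZ x Ax)) => k [/rP[+ _]]; exact.
move=> x x' y Ax Ax' Fr Fr'.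
have [k [[ZkB [Zx Zx']] [rx rx']]] :=
  filter_ex (filterI (filterI ZB (filterI (AZ x Ax) (AZ x' Ax')))
                     (filterI Fr Fr')).
by have [_ rinj] := rP k ZkB; exact: rinj rx rx'.
Qed.

End CompleteUltrafilter.

(** * Normal covers *)

(* [Y] represents [{j(x) | x in X}] in the ultrapower by [F]. *)
Record normal_cover {K X} (F : set_system K) (Y : K -> set X) : Prop := {
  cover_small : forall k, Y k #< [set: K];
  cover_ae : forall x, F [set k | Y k x];
  cover_diagonal : forall Q : K -> X -> Prop, (forall x, F [set k | Q k x]) ->
    F [set k | forall x, Y k x -> Q k x] }.
Arguments cover_small {K X F Y}.
Arguments cover_ae {K X F Y}.
Arguments cover_diagonal {K X F Y}.

(** Order [X] by its initial type and let [f] be minimal, modulo [F], among the functions exceeding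
    every constant; [Y k] is the segment below [f k]. By minimality, a function below [f] is
    constant modulo [F], which yields the diagonal property. *)
Lemma normal_cover_exists K (X : choiceType) (F : set_system K) :
  UltraFilter F -> complete_filter F -> (forall x, F <> principal_filter x) ->
  ~ countable [set: K] -> [set: X] #= [set: K] ->
  exists Y : K -> set X, normal_cover F Y.
Proof.
move=> UF cF npF uncK cardX.
have [lt [wf tri small]] := small_wf_order X.
have smallK x : [set y | lt y x] #< [set: K].
  by apply: (card_lt_le_trans _ (small x)); move: cardX => /card_eqPle[].
have nat_lt : [set: nat] #< [set: K].
  by split => //; apply/infiniteP => /finite_set_countable.
have null A : A #< [set: K] -> F [set k | ~ A k].
  move=> smallA; apply: filterS (complete_small cF A (fun a => ~` [set a]) smallA _).
    by move=> k nA Ak; exact: nA k Ak erefl.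
  move=> a _; apply: ultra_not => Fa; apply: (npF a).
  apply: (@max_filter _ _ (principal_filter_ultra a)) => W Wa.
  by apply: filterS Fa; exact: Wa.
pose unbounded (f : K -> X) := forall x, F [set k | lt x (f k)].
(* Any injection works: segments and points have small, hence null, preimages. *)
have [g unb_g] : exists g, unbounded g.
  have [|g ginj _] := @card_leT_fun K X setT; first by move: cardX => /card_eqPle[].
  exists g => x; have lt_null : F [set k | ~ lt (g k) x].
    apply: null; apply: (card_le_lt_trans _ _ (smallK x)).
    by apply: (card_le_inj g) => // k k' _ _; exact: ginj.
  have eq_null : F [set k | g k <> x].
    apply: null; apply: (card_le_lt_trans _ _ nat_lt).
    apply: card_le_trans (finite_set_countable (finite_set1 x)).
    by apply: (card_le_inj g) => // k k' _ _; exact: ginj.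
  apply: filterS (filterI lt_null eq_null) => k [nlt neq].
  by have [] := tri (g k) x.
have [f unb_f min_f] : exists2 f, unbounded f &
    forall h, unbounded h -> ~ F [set k | lt (h k) (f k)].
  (* Otherwise iteration gives functions decreasing modulo [F], and countable completeness finds one
     [k] at which all of them decrease. *)
  apply: contrapT => nmin.
  have /choice[next nextP] : forall f, exists h, unbounded f ->
      unbounded h /\ F [set k | lt (h k) (f k)].
    move=> f; apply: contrapT => nh; apply: nmin; exists f.
      by apply: contrapT => nf; apply: nh; exists f.
    by move=> h uh Fh; apply: nh; exists h.
  pose s n := iter n next g.
  have unb_s n : unbounded (s n) by elim: n => [|n /nextP[]].
  have [k desc] : [set k | forall n, [set: nat] n -> lt (s n.+1 k) (s n k)] !=set0.
    apply: (@filter_ex _ F).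
    apply: (complete_small cF _ (fun n => [set k | lt (s n.+1 k) (s n k)])) => // n _.
    by have [] := nextP _ (unb_s n).
  suff nacc x : Acc lt x -> forall n, s n k <> x by exact: nacc (wf (s 0 k)) 0 erefl.
  elim=> y _ IH n sny; apply: (IH (s n.+1 k)) erefl.
  by rewrite -sny; exact: desc.
exists (fun k => [set x | lt x (f k)]); split => // Q FQ.
apply: contrapT => nFQ.
have /choice[h hP] : forall k, exists x, ~ (forall x, lt x (f k) -> Q k x) ->
    lt x (f k) /\ ~ Q k x.
  move=> k; have [?|] := pselect (forall x, lt x (f k) -> Q k x).
    by exists (f k).
  by move=> /existsNP[x /not_implyP[xf nQ]]; exists x.
have FhQ : F [set k | lt (h k) (f k) /\ ~ Q k (h k)].
  by apply: filterS (ultra_not UF _ nFQ) => k /hP.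
(* Being below [f], [h] is not unbounded: it stays at or below some [x], and completeness pins it to
   one value. *)
have [a Fa] : exists a, F [set k | h k = a].
  have /existsNP[x nFx] : ~ unbounded h.
    by move=> /min_f; apply; apply: filterS FhQ => k [].
  have [|/(ultra_not UF) Fne] := pselect (F [set k | h k = x]); first by exists x.
  have [|a _ Fa] := complete_choose UF cF _ (fun k a => h k = a) (smallK x).
    apply: filterS (filterI Fne (ultra_not UF _ nFx)) => k [neq nlt].
    by exists (h k) => //; have [] := tri (h k) x.
  by exists a.
have [k [[[_ nQ] hka]]] := filter_ex (filterI (filterI FhQ Fa) (FQ a)).
by rewrite -hka.
Qed.

(** * Relativisation to open subspaces *)

(** At a point outside [D] the neighbourhood misses [D], at a point of [D] it isolates. This
    pointwise form can be imposed on the points of a subset only. *)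
Lemma closed_discreteP {X : topologicalType} (D : set X) : closed_discrete D <->
  forall x, exists2 N, nbhs x N & N `&` D `<=` [set x].
Proof.
split=> [[clD discD] x|discD].
  have [/discD[_ [N Nx ND]]|nDx] := pselect (D x); first by exists N; rewrite ?ND.
  have /existsNP[N /not_implyP[Nx nDN]] : ~ closure D x by move=> /clD.
  by exists N => // y [Ny Dy]; exfalso; apply: nDN; exists y.
split=> [x clDx|x Dx].
  have [N Nx ND] := discD x.
  by have [y [Dy Ny]] := clDx N Nx; rewrite -(ND y (conj Ny Dy)).
split; first exact: mem_set.
have [N Nx ND] := discD x; exists N => //; apply/seteqP; split=> // _ ->.
by split=> //; exact: nbhs_singleton.
Qed.

Section Relative.
Context {X : topologicalType}.
Implicit Types (D Y : set X) (V : X -> set X).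

(** For open [Y], this is stickiness in the subspace [Y], phrased inside [X] so that sets coming
    from different [Y k] can be compared. *)
Definition relatively_sticky Y V D : Prop :=
  [/\ D `<=` Y,
      forall x, Y x -> exists2 N, nbhs x N & N `&` D `<=` [set x] &
      forall x, Y x -> V x `&` D !=set0 -> (\bigcup_(y in D) V y) x].

Definition relatively_sigma_D_wrt S Y V : Prop :=
  forall D x, relatively_sticky Y V D -> D #< [set: S] -> Y x ->
    exists D', [/\ relatively_sticky Y V D', D' #< [set: S],
                   sticky_le V D D' & (\bigcup_(y in D') V y) x].

Lemma relatively_stickyT V D : relatively_sticky setT V D <-> sticky V D.
Proof.
split=> [[_ discD stD]|[/closed_discreteP discD stD]].
  by split=> [|x]; [apply/closed_discreteP => x; exact: discD|exact: stD].
by split=> [//|x _|x _]; [exact: discD|exact: stD].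
Qed.

Section Subspace.
Context {Y : set X} (openY : open Y).
Local Notation val := (set_val : subspace_of Y -> X).

Lemma nbhs_subspace (y : subspace_of Y) (N : set (subspace_of Y)) :
  nbhs y N <-> nbhs (val y) (val @` N).
Proof.
split.
  rewrite nbhsE => -[O [[A openA <-] Ay] ON].
  have : nbhs (val y) (A `&` Y).
    by apply: open_nbhs_nbhs; split; [exact: openI|split=> //; exact: set_valP].
  apply: filterS => z [Az Yz]; exists (SigSub (mem_set Yz)) => //.
  exact: ON.
move=> Nval; have : nbhs y (val @^-1` (val @` N)).
  exact: (@initial_continuous _ _ (set_val : Y -> X) y _ Nval).
by apply: filterS => z [z' Nz' /val_inj <-].
Qed.

Context (V : X -> set X).
Let W (y : subspace_of Y) : set (subspace_of Y) := val @^-1` V (val y).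

Lemma bigcup_subspace (D : set (subspace_of Y)) z :
  (\bigcup_(y in D) W y) z <-> (\bigcup_(x in val @` D) V x) (val z).
Proof.
split=> [[y Dy Wyz]|[_ [y Dy <-] Vyz]]; last by exists y.
by exists (val y) => //; exists y.
Qed.

Lemma sticky_subspace (D : set (subspace_of Y)) :
  sticky W D <-> relatively_sticky Y V (val @` D).
Proof.
split=> [[/closed_discreteP discD stD]|[_ discD stD]].
  split.
  - by move=> _ [y _ <-]; exact: set_valP.
  - move=> x Yx; have [N Nx ND] := discD (SigSub (mem_set Yx)).
    exists (val @` N); first by move/nbhs_subspace: Nx.
    by move=> _ [[y Ny <-] [y' Dy' /val_inj yy']]; rewrite (ND y) // -yy'; split=> //; rewrite yy'.
  - move=> x Yx [z [Vxz [y Dy yz]]].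
    apply/(bigcup_subspace _ (SigSub (mem_set Yx)))/stD.
    by exists y; split=> //; rewrite /W /= yz.
split.
  apply/closed_discreteP => y; have [N Ny ND] := discD _ (set_valP y).
  exists (val @^-1` N); first exact: (@initial_continuous _ _ (set_val : Y -> X) y _ Ny).
  by move=> z [Nz Dz]; apply/val_inj/ND; split=> //; exists z.
move=> y [z [Wyz Dz]]; apply/bigcup_subspace/stD; first exact: set_valP.
by exists (val z); split=> //; exists z.
Qed.

Lemma sigma_D_wrt_subspace S :
  relatively_sigma_D_wrt S Y V -> sigma_D_wrt S W.
Proof.
have card_val (D : set (subspace_of Y)) : val @` D #<= D /\ D #<= val @` D.
  split; first exact: card_image_le.
  apply: (card_le_inj val) => [x Dx|x y _ _]; [by exists x|exact: val_inj].
move=> sD D x [/sticky_subspace stD smallD].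
have [|E [stE smallE [DE sepE] Ex]] := sD _ (val x) stD _ (set_valP x).
  exact: card_le_lt_trans (card_val D).1 smallD.
have valE : val @` (val @^-1` E) = E.
  apply/seteqP; split=> [_ [y Ey <-] //|y Ey].
  have [EY _ _] := stE.
  by exists (SigSub (mem_set (EY _ Ey))).
exists (val @^-1` E); split.
- split; first by apply/sticky_subspace; rewrite valE.
  by apply: card_le_lt_trans (card_val _).2 _; rewrite valE.
- split=> [y Dy|]; first by apply: DE; exists y.
  rewrite -subset0 => y [[Ey nDy] /bigcup_subspace Vy].
  suff : set0 (val y) by [].
  rewrite -sepE; split=> //; split=> // -[y' Dy' /val_inj yy'].
  by apply: nDy; rewrite -yy'.
- by apply/bigcup_subspace; rewrite valE.
Qed.

End Subspace.

(** Trades assignments on the subspace for assignments on [X], so that one [V] can be tested against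
    many [Y]. *)
Lemma sigma_D_subspace {Y} {S} : open Y ->
  (forall U : X -> set X, (forall x, Y x -> nbhs x (U x)) ->
    exists V, [/\ ona V, forall x, Y x -> V x `<=` U x &
                  relatively_sigma_D_wrt S Y V]) ->
  sigma_D (subspace_of Y) S.
Proof.
move=> openY relD U onaU.
pose val : subspace_of Y -> X := set_val.
have [x Yx|V [onaV VU sD]] :=
    (* The union has one term at a point of [Y] and none elsewhere, hence [U] is constrained only on
       [Y]. *)
    relD (fun x => \bigcup_(y in [set y | val y = x]) (val @` U y)).
  have : nbhs (SigSub (mem_set Yx) : subspace_of Y) (U (SigSub (mem_set Yx))).
    exact/open_nbhs_nbhs/onaU.
  move=> /(nbhs_subspace openY); apply: filterS => z Uz.
  by exists (SigSub (mem_set Yx)).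
exists (fun y => val @^-1` V (val y)); split.
- move=> y; have [openV Vy] := onaV (val y); split=> //.
  by exists (V (val y)).
- move=> y z /(VU _ (set_valP y))[y' /= /val_inj -> [z' Uz' /val_inj <-]].
  exact: Uz'.
- exact: (sigma_D_wrt_subspace openY).
Qed.

End Relative.

(** * Reflection along a normal cover *)

Section NormalCover.
Context {K : Type} {X : topologicalType} {F : set_system K} {Y : K -> set X}.
Hypotheses (UF : UltraFilter F) (cF : complete_filter F).
Hypothesis YF : normal_cover F Y.

Lemma small_subset_ae (A : set X) : A #< [set: K] -> F [set k | A `<=` Y k].
Proof.
move=> smallA; apply: (complete_small cF A (fun x => [set k | Y k x])) => // x _.
exact: cover_ae YF x.
Qed.

(** The pressing-down form of normality: [cover_diagonal] for the negation of [P]. *)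
Lemma normal_choose (P : K -> X -> Prop) :
  F [set k | exists2 x, Y k x & P k x] -> exists x, F [set k | P k x].
Proof.
move=> FP; apply: contrapT => /forallNP nP.
have FnP := cover_diagonal YF (fun k x => ~ P k x) (fun x => ultra_not UF _ (nP x)).
by have [k [[x Yx Px] /(_ x Yx)]] := filter_ex (filterI FP FnP).
Qed.

(** Failures in almost every [Y k] are merged into one pair [E], [x] in [X]. An extension [E'] of
    [E] in [X] is small, so it lies in almost every [Y k] and refutes the failure there. *)
Lemma sigma_D_wrt_ae {S : Type} {V : X -> set X} : [set: S] #< [set: K] ->
  sigma_D_wrt S V -> F [set k | relatively_sigma_D_wrt S (Y k) V].
Proof.
move=> smallS sD; apply: contrapT => /(ultra_not UF) Fbad.
pose bad k x D := [/\ relatively_sticky (Y k) V D, D #< [set: S], Y k x &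
  ~ exists D', [/\ relatively_sticky (Y k) V D', D' #< [set: S],
                   sticky_le V D D' & (\bigcup_(y in D') V y) x]].
have [x Fx] : exists x, F [set k | exists D, bad k x D].
  apply: normal_choose; apply: filterS Fbad => k.
  move=> /existsNP[D /existsNP[x /not_implyP[? /not_implyP[? /not_implyP[? ?]]]]].
  by exists x => //; exists D.
have /choice[D DP] : forall k, exists D, (exists D, bad k x D) -> bad k x D.
  move=> k; have [[D badD]|] := pselect (exists D, bad k x D); last by exists set0.
  by exists D.
have {Fx}Fbad' : F [set k | bad k x (D k)] by apply: filterS Fx => k /DP.
(* The limit of the [D k] along [F]. Normality makes it agree with [D k] on [Y k]; once [E] is known
   to be small, it lies in [Y k] and equals [D k]. *)
pose E := [set y | F [set k | D k y]].
have FDE : F [set k | forall y, Y k y -> (D k y <-> E y)].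
  apply: (cover_diagonal YF (fun k y => D k y <-> E y)) => y.
  have [Ey|nEy] := pselect (E y); first by apply: filterS (Ey) => k Dy; split.
  by apply: filterS (ultra_not UF _ nEy) => k nDy; split.
have smallE : E #< [set: K].
  apply: (card_le_lt_trans _ _ smallS).
  apply: (ultraproduct_card_le UF cF E D _ smallS) => //.
  by apply: filterS Fbad' => k [_ []].
have {FDE}FD : F [set k | D k = E].
  apply: filterS (filterI FDE (filterI Fbad' (small_subset_ae _ smallE))).
  move=> k [DE [[[DY _ _] _ _ _] EY]]; apply/seteqP; split=> y.
    by move=> Dy; apply/DE => //; exact: DY.
  by move=> Ey; apply/DE => //; exact: EY.
have {Fbad'}FE : F [set k | bad k x E].
  by apply: filterS (filterI Fbad' FD) => k /= [+ <-].
have [k0 [_ ltES _ _]] := filter_ex FE.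
have stE : sticky V E.
  (* Both conditions concern one point [y] at a time, and [y] lies in some [Y k] where [E] is
     relatively sticky. *)
  apply/relatively_stickyT; split=> // y _.
    have [k [[[_ discE _] _ _ _] Yy]] := filter_ex (filterI FE (cover_ae YF y)).
    exact: discE.
  have [k [[[_ _ stE] _ _ _] Yy]] := filter_ex (filterI FE (cover_ae YF y)).
  exact: stE.
have [E' [[/relatively_stickyT[_ discE' stE'] ltE'S] leE E'x]] := sD E x (conj stE ltES).
have FE' : F [set k | E' `<=` Y k].
  by apply: small_subset_ae; exact: (card_lt_le_trans _ ltE'S smallS.1).
have [k [[_ _ _ nE'] E'Y]] := filter_ex (filterI FE FE').
apply: nE'; exists E'; split=> //; split=> // y _; [exact: discE'|exact: stE'].
Qed.

End NormalCover.

(** * Openness, size and the sigma-D property of almost every [Y k] *)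

Theorem theorem3p4 (kappa : Type) (X : topologicalType) (sigma : Type)
  (hkappa : measurable_cardinal kappa)
  (hX : hausdorff_space X)
  (hloc : locally_lt X kappa)
  (hcard : [set: X] #= [set: kappa])
  (hbase : forall x : X,
     exists2 B : set (set X), point_base x B & B #< [set: kappa])
  (hsigma_reg : regular_cardinal sigma)
  (hsigma_unc : ~ countable [set: sigma])
  (hsigma_lt : [set: sigma] #< [set: kappa])
  (hD : sigma_D X sigma) :
  forall theta : Type, [set: theta] #< [set: kappa] ->
    exists Y : set X,
      [/\ open Y, sigma_D (subspace_of Y) sigma,
          [set: theta] #< Y & Y #< [set: kappa]].
Proof.
move=> theta smalltheta.
have [uncK [F [UF npF cF]]] := hkappa.
have [Y YF] := normal_cover_exists kappa X F UF cF npF uncK hcard.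
have [U0 onaU0 smallU0] := hloc.
have Fopen : F [set k | open (Y k)].
  (* Each [U0 x] is small, hence inside almost every [Y k]; the diagonal property treats all [x] in
     [Y k] together. *)
  have FU0 : F [set k | forall x, Y k x -> U0 x `<=` Y k].
    apply: (cover_diagonal YF (fun k x => U0 x `<=` Y k)) => x.
    exact: (small_subset_ae cF YF).
  apply: filterS FU0 => k U0Y; rewrite openE => x Yx.
  by apply: filterS (U0Y x Yx) _; exact/open_nbhs_nbhs/onaU0.
have Flarge : F [set k | [set: theta] #< Y k].
  have [e einj _] : exists2 e : theta -> X, injective e & forall t, [set: X] (e t).
    by apply: card_leT_fun; rewrite (card_le_eqr hcard) ; exact: smalltheta.1.
  have Fle : F [set k | [set: theta] #<= Y k].
    have := small_subset_ae cF YF (e @` setT)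
              (card_le_lt_trans _ (card_image_le _ _) smalltheta).
    apply: filterS => k eY; apply: (card_le_inj e) => [t _|t t' _ _]; last exact: einj.
    by apply: eY; exists t.
  (* Otherwise all of [X], sitting inside the ultraproduct of the [Y k], would inject into
     [theta]. *)
  have nFge : ~ F [set k | Y k #<= [set: theta]].
    move=> Fge; apply: smalltheta.2; rewrite -(card_le_eql hcard).
    by apply: (ultraproduct_card_le UF cF _ Y) => // x _; exact: cover_ae YF x.
  by apply: filterS (filterI Fle (ultra_not UF _ nFge)) => k [].
have FD : F [set k | sigma_D (subspace_of (Y k)) sigma].
  apply: contrapT => /(ultra_not UF)/(filterI Fopen) Fbad.
  have /choice[U UP] : forall k, exists U : X -> set X,
      open (Y k) /\ ~ sigma_D (subspace_of (Y k)) sigma ->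
      (forall x, Y k x -> nbhs x (U x)) /\
      ~ exists V, [/\ ona V, forall x, Y k x -> V x `<=` U x &
                      relatively_sigma_D_wrt sigma (Y k) V].
    move=> k; apply: contrapT => nU; apply: (nU); exists (fun=> setT) => -[openY nD].
    exfalso; apply: nD; apply: sigma_D_subspace => // U UY.
    by apply: contrapT => nV; apply: nU; exists U.
  (* As [x] has a small base, one basic set lies inside [U k x] for almost every [k]; so a single
     assignment [b] on [X] stands for all the [U k]. *)
  have /choice[b bP] : forall x, exists b, open_nbhs x b /\ F [set k | b `<=` U k x].
    move=> x; have [B [Bopen Bbase] smallB] := hbase x.
    have [|b Bb Fb] := complete_choose UF cF B (fun k b => b `<=` U k x) smallB.
      by apply: filterS (filterI Fbad (cover_ae YF x)) => k [/UP[UY _] /UY/Bbase].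
    by exists b; split=> //; exact: Bopen.
  have [V [onaV Vb sDV]] := hD b (fun x => (bP x).1).
  (* For almost every [k], [b] and hence [V] is inside [U k] at all points of [Y k], which
     contradicts the choice of [U k]. *)
  have FV := cover_diagonal YF (fun k x => b x `<=` U k x) (fun x => (bP x).2).
  have [k [/UP[_ nV] [VU relV]]] := filter_ex (filterI Fbad (filterI FV
    (sigma_D_wrt_ae UF cF YF hsigma_lt sDV))).
  apply: nV; exists V; split=> // x Yx.
  by apply: subset_trans (Vb x) _; exact: VU.
have [k [openY [sDY largeY]]] := filter_ex (filterI Fopen (filterI FD Flarge)).
by exists (Y k); split=> //; exact: cover_small YF k.
Qed.
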